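(* Let $R$ be a domain with the $D$-property. If $R$ has the $L$-property, then $R$ is a duo domain.
   Context: Rings are associative (not necessarily commutative) with $1\neq 0$. $U(R)$ is the group of units of $R$. $R$ has the $D$-property if for each $a\in R$ there is $a_*\in R$ with $RaR=a_*R=Ra_*$. $R$ has the $L$-property if for every $a\in R$, $RaR=R$ implies $a\in U(R)$. A nonzero element $a\in R$ is duo if $aR$ and $Ra$ are two-sided ideals and $aR=Ra$. A duo domain is a domain in which every nonzero element is duo (equivalently, every one-sided ideal is two-sided). *)

(* Defs.v *)
From mathcomp Require Import all_boot all_algebra.
From mathcomp Require Import classical_sets.

Set Implicit Arguments.
Unset Strict Implicit.
Unset Printing Implicit Defensive.

Import GRing.Theory.

Local Open Scope classical_set_scope.
Local Open Scope ring_scope.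

(* The base structure is nzRingType (1 != 0, no commutativity). MathComp's
   unitRingType also asks for a boolean test of invertibility; to avoid this
   extra structure, U(R) is defined as a Prop. *)

(* integral_domain_axiom only says that there are no zero divisors; it does not
   involve commutativity. *)
Definition is_domain (R : nzRingType) : Prop := GRing.integral_domain_axiom R.

(* U(R) *)
Definition units (R : nzRingType) : set R :=
  [set a | exists b : R, a * b = 1 /\ b * a = 1].

(* aR *)
Definition right_principal (R : nzRingType) (a : R) : set R :=
  [set x | exists r : R, x = a * r].

(* Ra *)
Definition left_principal (R : nzRingType) (a : R) : set R :=
  [set x | exists r : R, x = r * a].

(* RaR: since R is not commutative, the products r * a * s do not form an
   additive subgroup in general, so finite sums of them are needed. *)
Definition two_sided_principal (R : nzRingType) (a : R) : set R :=
  [set x | exists s : seq (R * R), x = \sum_(p <- s) p.1 * a * p.2].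

Definition is_two_sided_ideal (R : nzRingType) (I : set R) : Prop :=
  [/\ I 0,
      forall x y : R, I x -> I y -> I (x - y),
      forall r x : R, I x -> I (r * x) &
      forall x r : R, I x -> I (x * r)].

Definition D_property (R : nzRingType) : Prop :=
  forall a : R, exists b : R,
    two_sided_principal a = right_principal b /\
    right_principal b = left_principal b.

Definition L_property (R : nzRingType) : Prop :=
  forall a : R, two_sided_principal a = [set: R] -> units a.

Definition is_duo (R : nzRingType) (a : R) : Prop :=
  [/\ a <> 0,
      is_two_sided_ideal (right_principal a),
      is_two_sided_ideal (left_principal a) &
      right_principal a = left_principal a].

Definition is_duo_domain (R : nzRingType) : Prop :=
  is_domain R /\ forall a : R, a <> 0 -> is_duo a.

(* Main.v *)
Require Import Defs.
From mathcomp Require Import all_boot all_algebra.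
From mathcomp Require Import classical_sets.

(** Let [a] be nonzero and let [b] be given by the D-property, so that
    [RaR = bR = Rb]. Since [a] lies in [RaR], it factors as [a = bc = db], and
    [b] is nonzero. Now [b] is itself a finite sum of products
    [r * a * s = r * (b * c) * s]. As [Rb] is contained in [bR], the factor [b]
    can be moved to the left past each [r], so [b = bz] with [z] in [RcR]
    ([two_sided_principal_mull]). Cancelling [b] gives [z = 1], hence
    [RcR = R], and [c] is a unit by the L-property. The mirror argument
    ([two_sided_principal_mulr]) shows that [d] is a unit. Therefore
    [aR = bcR = bR] and [Ra = Rdb = Rb]: both coincide with [RaR], which is a
    two-sided ideal. *)

Set Implicit Arguments.
Unset Strict Implicit.
Unset Printing Implicit Defensive.

Import GRing.Theory.

Local Open Scope classical_set_scope.
Local Open Scope ring_scope.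

Lemma domain_mulfI (R : nzRingType) (b : R) :
  is_domain R -> b <> 0 -> injective ( *%R b).
Proof.
move=> hdom b0 x y /= /eqP; rewrite -subr_eq0 -mulrBr => /eqP /hdom.
by case/orP => [/eqP//|]; rewrite subr_eq0 => /eqP.
Qed.

Lemma domain_mulIf (R : nzRingType) (b : R) :
  is_domain R -> b <> 0 -> injective ( *%R^~ b).
Proof.
move=> hdom b0 x y /= /eqP; rewrite -subr_eq0 -mulrBl => /eqP /hdom.
by case/orP => [|/eqP//]; rewrite subr_eq0 => /eqP.
Qed.

Lemma two_sided_principal_id (R : nzRingType) (a : R) :
  two_sided_principal a a.
Proof. by exists [:: (1, 1)]; rewrite big_seq1 mul1r mulr1. Qed.

Lemma two_sided_principal_ideal (R : nzRingType) (a : R) :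
  is_two_sided_ideal (two_sided_principal a).
Proof.
split=> [|x y [s ->] [t ->]|r x [s ->]|x r [s ->]].
- by exists [::]; rewrite big_nil.
- exists (s ++ [seq (- p.1, p.2) | p <- t]).
  rewrite big_cat big_map /= -sumrN; congr (_ + _).
  by apply: eq_bigr => p _; rewrite !mulNr.
- exists [seq (r * p.1, p.2) | p <- s].
  by rewrite big_map mulr_sumr; apply: eq_bigr => p _; rewrite !mulrA.
- exists [seq (p.1, p.2 * r) | p <- s].
  by rewrite big_map mulr_suml; apply: eq_bigr => p _; rewrite !mulrA.
Qed.

Lemma two_sided_principal_full (R : nzRingType) (a : R) :
  two_sided_principal a 1 -> two_sided_principal a = [set: R].
Proof.
move=> a1; apply/seteqP; split=> // x _.
have [_ _ idealMl _] := two_sided_principal_ideal a.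
by rewrite -[x]mulr1; exact: idealMl.
Qed.

Lemma two_sided_principal_mull (R : nzRingType) (b c y : R) :
  left_principal b `<=` right_principal b -> two_sided_principal (b * c) y ->
  exists2 z, two_sided_principal c z & y = b * z.
Proof.
move=> sub [s ->{y}]; elim: s => [|[r t] s [_ [u ->] IH]].
  by exists 0; [exists [::] |]; rewrite big_nil ?mulr0.
have [r' rb] : right_principal b (r * b) by apply: sub; exists r.
exists (r' * c * t + \sum_(p <- u) p.1 * c * p.2).
  by exists ((r', t) :: u); rewrite big_cons.
by rewrite big_cons IH /= mulrDr !mulrA rb.
Qed.

Lemma two_sided_principal_mulr (R : nzRingType) (b d y : R) :
  right_principal b `<=` left_principal b -> two_sided_principal (d * b) y ->
  exists2 z, two_sided_principal d z & y = z * b.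
Proof.
move=> sub [s ->{y}]; elim: s => [|[r t] s [_ [u ->] IH]].
  by exists 0; [exists [::] |]; rewrite big_nil ?mul0r.
have [t' bt] : left_principal b (b * t) by apply: sub; exists t.
exists (r * d * t' + \sum_(p <- u) p.1 * d * p.2).
  by exists ((r, t') :: u); rewrite big_cons.
by rewrite big_cons IH /= mulrDl -!mulrA bt.
Qed.

Lemma right_principal_mulr_unit (R : nzRingType) (b c : R) :
  units c -> right_principal (b * c) = right_principal b.
Proof.
move=> [c' [cc' _]]; apply/seteqP; split=> _ [r ->].
  by exists (c * r); rewrite mulrA.
by exists (c' * r); rewrite mulrA -(mulrA b) cc' mulr1.
Qed.

Lemma left_principal_mull_unit (R : nzRingType) (b d : R) :
  units d -> left_principal (d * b) = left_principal b.
Proof.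
move=> [d' [_ d'd]]; apply/seteqP; split=> _ [r ->].
  by exists (r * d); rewrite mulrA.
by exists (r * d'); rewrite -!mulrA (mulrA d') d'd mul1r.
Qed.

Theorem theorem2p8 (R : nzRingType) (hdom : is_domain R)
  (hD : D_property R) (hL : L_property R) : is_duo_domain R.
Proof.
split=> // a a0; have [b [RaR bRb]] := hD a.
have aRb : right_principal b a by rewrite -RaR; exact: two_sided_principal_id.
have [c ac] := aRb.
have [d ad] : left_principal b a by rewrite -bRb.
have b0 : b <> 0 by move=> b0; apply: a0; rewrite ac b0 mul0r.
have RaRb : two_sided_principal a b by rewrite RaR; exists 1; rewrite mulr1.
have c_unit : units c.
  apply/hL/two_sided_principal_full.
  have [||z cz bz] := @two_sided_principal_mull R b c b; rewrite -?ac ?bRb//.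
  suff -> : 1 = z by [].
  by apply: (domain_mulfI hdom b0); rewrite mulr1.
have d_unit : units d.
  apply/hL/two_sided_principal_full.
  have [||z dz bz] := @two_sided_principal_mulr R b d b; rewrite -?ad ?bRb//.
  suff -> : 1 = z by [].
  by apply: (domain_mulIf hdom b0); rewrite mul1r.
have aR : right_principal a = two_sided_principal a.
  by rewrite RaR ac right_principal_mulr_unit.
have Ra : left_principal a = two_sided_principal a.
  by rewrite RaR bRb ad left_principal_mull_unit.
by split; rewrite ?aR ?Ra //; exact: two_sided_principal_ideal.
Qed.
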